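(* Let $\{\pi_{\boldsymbol{\theta}}\}_{\boldsymbol{\theta}\in\mathbb{R}^d}$ be a parametrized family of stochastic policies for a Markov decision process, and let $J(\boldsymbol{\theta})=\mathbb{E}_{\tau\sim\pi_{\boldsymbol{\theta}}}\left[\sum_{t\ge 0}\gamma^t r_t\right]$ be the expected discounted return. Assume that $J:\mathbb{R}^d\to\mathbb{R}$ is $L$-smooth for some $L>0$. Let $\boldsymbol{\theta}_k\in\mathbb{R}^d$, let $0<\eta<2/L$, and set $$\boldsymbol{\theta}_k^{\mathrm{explore}}=\boldsymbol{\theta}_k+\eta\,\nabla_{\boldsymbol{\theta}}J(\boldsymbol{\theta}_k).$$ If $\nabla_{\boldsymbol{\theta}}J(\boldsymbol{\theta}_k)\neq 0$, then $J(\boldsymbol{\theta}_k^{\mathrm{explore}})>J(\boldsymbol{\theta}_k)$.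
   Context: The Markov decision process has state space $\mathcal{S}$, action space $\mathcal{A}$, transition kernel $p(s_{t+1}\mid s_t,a_t)$, reward function $\mathcal{R}:\mathcal{S}\times\mathcal{A}\times\mathcal{S}\to\mathbb{R}$ and discount factor $\gamma\in[0,1)$, together with a fixed initial state distribution. The notation $\tau\sim\pi_{\boldsymbol{\theta}}$ means that $\tau=(s_0,a_0,s_1,a_1,\dots)$ is a random trajectory with $s_0$ drawn from the initial distribution, $a_t\sim\pi_{\boldsymbol{\theta}}(\cdot\mid s_t)$, $s_{t+1}\sim p(\cdot\mid s_t,a_t)$, and $r_t=\mathcal{R}(s_t,a_t,s_{t+1})$. The expected return $J(\boldsymbol{\theta})$ is assumed to be well defined and finite for all $\boldsymbol{\theta}$. A function $J:\mathbb{R}^d\to\mathbb{R}$ is $L$-smooth if it is differentiable and $\|\nabla J(\boldsymbol{\theta})-\nabla J(\boldsymbol{\theta}')\|\le L\|\boldsymbol{\theta}-\boldsymbol{\theta}'\|$ for all $\boldsymbol{\theta},\boldsymbol{\theta}'\in\mathbb{R}^d$ (Euclidean norm). *)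

(* Defs.v *)
From HB Require Import structures.
From mathcomp Require Import all_boot all_order all_algebra.
From mathcomp Require Import all_classical all_reals all_analysis.

Set Implicit Arguments.
Unset Strict Implicit.
Unset Printing Implicit Defensive.

Import Order.TTheory GRing.Theory Num.Theory.
Import numFieldNormedType.Exports.

Local Open Scope classical_set_scope.
Local Open Scope ring_scope.

Section Smoothness.
Context {R : realType} {d : nat}.
Implicit Types (J : 'rV[R]_d -> R) (x v : 'rV[R]_d).

(* The library norm `|v| on 'rV[R]_d is the sup norm. It induces the same
   topology, hence the same differentiability, but not the same Lipschitz
   constants. *)
Definition euclidean_norm v : R := Num.sqrt (\sum_(i < d) v 0 i ^+ 2).

Definition gradient J x : 'rV[R]_d := \row_(i < d) 'D_(delta_mx 0 i) J x.

Definition L_smooth (L : R) J : Prop :=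
  (forall x, differentiable J x) /\
  (forall x y, euclidean_norm (gradient J x - gradient J y)
               <= L * euclidean_norm (x - y)).

End Smoothness.

Record MDP {dS dA : measure_display} (S : measurableType dS)
    (A : measurableType dA) (R : realType) := mkMDP {
  transition : R.-pker (S * A)%type ~> S ;
  reward : {mfun (S * A * S)%type >-> R} ;
  discount : R ;
  discount_ge0 : 0 <= discount ;
  discount_lt1 : discount < 1 ;
  initial : probability S R }.

Section Trajectories.
Context {dS dA : measure_display} (S : measurableType dS)
  (A : measurableType dA).

Definition state (t : nat) (tau : nat -> S * A) : S := (tau t).1.
Definition action (t : nat) (tau : nat -> S * A) : A := (tau t).2.

(* Events about a single s_t with t in I, or about a single a_t with t in K. *)
Definition coordinate_events (I K : set nat) : set (set (nat -> S * A)) :=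
  [set E | (exists2 t, I t &
              exists2 B, measurable B & E = state t @^-1` B)
        \/ (exists2 t, K t &
              exists2 C, measurable C & E = action t @^-1` C)].

(* Sequences (s_0, a_0), (s_1, a_1), ... with the product sigma-algebra. *)
Definition trajectory := g_sigma_algebraType (coordinate_events setT setT).

(* The sigma-algebra generated by s_i for i < m and a_j for j < n. *)
Definition history (m n : nat) : set (set trajectory) :=
  <<s coordinate_events `I_m `I_n >>.

End Trajectories.

Section Return.
Context {dS dA : measure_display} {S : measurableType dS}
  {A : measurableType dA} {R : realType}.
Variable M : MDP S A R.

(* P is the law of tau ~ pi: s_0 has law initial M; the conditional law of a_t
   given s_0, a_0, ..., s_t is pi(. | s_t); and the conditional law of s_{t+1}
   given s_0, a_0, ..., s_t, a_t is p(. | s_t, a_t). By the Ionescu-Tulcea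
   theorem exactly one P satisfies this. *)
Definition trajectory_law (pi : R.-pker S ~> A)
    (P : probability (trajectory S A) R) : Prop :=
  [/\ forall B : set S, measurable B ->
        P (state 0 @^-1` B) = initial M B,
      forall (t : nat) (E : set (trajectory S A)) (C : set A),
        history t.+1 t E -> measurable C ->
        P (E `&` action t @^-1` C)
        = (\int[P]_(tau in E) pi (state t tau) C)%E
    & forall (t : nat) (E : set (trajectory S A)) (B : set S),
        history t.+1 t.+1 E -> measurable B ->
        P (E `&` state t.+1 @^-1` B)
        = (\int[P]_(tau in E) transition M (state t tau, action t tau) B)%E ].

Definition step_reward (tau : trajectory S A) (t : nat) : R :=
  reward M (state t tau, action t tau, state t.+1 tau).

Definition discounted_rewards (tau : trajectory S A) : R^nat :=
  fun t => discount M ^+ t * step_reward tau t.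

Definition discounted_return (tau : trajectory S A) : R :=
  limn (series (discounted_rewards tau)).

Definition return_well_defined (P : probability (trajectory S A) R) : Prop :=
  {ae P, forall tau, cvgn (series (discounted_rewards tau))} /\
  P.-integrable [set: trajectory S A] (EFin \o discounted_return).

Definition expected_return (P : probability (trajectory S A) R) : R :=
  fine ('E_P [discounted_return])%E.

End Return.

(* Main.v *)
Require Import Defs.
From HB Require Import structures.
From mathcomp Require Import all_boot all_order all_algebra.
From mathcomp Require Import all_classical all_reals all_analysis.
From mathcomp Require Import ring lra.

Set Implicit Arguments.
Unset Strict Implicit.
Unset Printing Implicit Defensive.

Import Order.TTheory GRing.Theory Num.Theory.
Import numFieldNormedType.Exports.

Local Open Scope classical_set_scope.
Local Open Scope ring_scope.

(** Along the segment from [theta_k] to [theta_explore] the slope of [J] starts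
    at [eta |g|^2], where [g] is the gradient at [theta_k]; by smoothness it drops
    by at most [t L eta^2 |g|^2] at time [t]. Correcting [J] by the corresponding
    quadratic and applying the mean value theorem, the gain is at least
    [eta (1 - L eta / 2) |g|^2 > 0]. *)

Section AscentLemma.
Context {R : realType} {d : nat}.
Implicit Types (J : 'rV[R]_d -> R) (x v a b : 'rV[R]_d).

Definition dot a b : R := \sum_(i < d) a 0 i * b 0 i.

Lemma dotBl a b v : dot (a - b) v = dot a v - dot b v.
Proof.
rewrite /dot -sumrB; apply: eq_bigr => i _.
by rewrite !mxE mulrBl.
Qed.

Lemma dotZr (c : R) a b : dot a (c *: b) = c * dot a b.
Proof.
by rewrite /dot mulr_sumr; apply: eq_bigr => i _; rewrite mxE mulrCA.
Qed.

Lemma dotZl (c : R) a b : dot (c *: a) b = c * dot a b.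
Proof.
by rewrite /dot mulr_sumr; apply: eq_bigr => i _; rewrite mxE mulrA.
Qed.

Lemma dotvv_ge0 v : 0 <= dot v v.
Proof. by apply: sumr_ge0 => i _; rewrite -expr2 sqr_ge0. Qed.

Lemma dotvv_gt0 v : v != 0 -> 0 < dot v v.
Proof.
move=> v0; rewrite lt_neqAle dotvv_ge0 andbT eq_sym; apply: contraNN v0.
rewrite psumr_eq0 => [/allP v0|i _]; last by rewrite -expr2 sqr_ge0.
apply/eqP/rowP => i; rewrite mxE.
by have := v0 i (mem_index_enum i); rewrite /= mulf_eq0 orbb => /eqP.
Qed.

Lemma euclidean_norm_sqr v : euclidean_norm v ^+ 2 = dot v v.
Proof.
have -> : dot v v = \sum_(i < d) v 0 i ^+ 2 by [].
by rewrite sqr_sqrtr // sumr_ge0 // => i _; rewrite sqr_ge0.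
Qed.

Lemma euclidean_norm_ge0 v : 0 <= euclidean_norm v.
Proof. exact: sqrtr_ge0. Qed.

(** A one-sided Cauchy-Schwarz bound: expand [0 <= |a + c b|^2], bound [|a|^2] by [c^2 |b|^2], and
    divide by [2 c]. *)
Lemma dot_ge_of_norm_le (c : R) a b : 0 < c ->
  euclidean_norm a <= c * euclidean_norm b -> - (c * dot b b) <= dot a b.
Proof.
move=> c0 ab; rewrite -subr_ge0 opprK -(pmulr_rge0 _ (mulr_gt0 (ltr0n _ 2) c0)).
have : dot a a <= c ^+ 2 * dot b b.
  by rewrite -!euclidean_norm_sqr -exprMn lerXn2r ?nnegrE ?mulr_ge0
             ?euclidean_norm_ge0 // ltW.
have : 0 <= dot a a + 2 * c * dot a b + c ^+ 2 * dot b b.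
  rewrite /dot !mulr_sumr -!big_split /= sumr_ge0 // => i _.
  by have := sqr_ge0 (a 0 i + c * b 0 i); lra.
lra.
Qed.

(** The differential is linear, so expanding [v] in the standard basis leaves only partial
    derivatives. *)
Lemma derive_gradient J x v : differentiable J x -> 'D_v J x = dot (gradient J x) v.
Proof.
move=> Jx; rewrite deriveE // {1}(row_sum_delta v) linear_sum /dot.
by apply: eq_bigr => i _; rewrite linearZ /= mxE deriveE // mulrC.
Qed.

Lemma is_derive_line J x v (t : R) : differentiable J (x + t *: v) ->
  is_derive t 1 (fun s : R => J (x + s *: v)) (dot (gradient J (x + t *: v)) v).
Proof.
move=> Jt.
(* The difference quotient of the restriction to the line equals that of [J] along [v], so no chain
   rule is invoked. *)
have E : (fun h : R => h^-1 *: (((fun s : R => J (x + s *: v)) \o shift t) (h *: 1)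
            - J (x + t *: v)))
       = (fun h : R => h^-1 *: ((J \o shift (x + t *: v)) (h *: v) - J (x + t *: v))).
  apply/funext => h /=; congr (_ *: (J _ - _)).
  by rewrite [h%:A]mulr1 scalerDl addrCA.
apply: DeriveDef; first by rewrite /derivable E; exact: diff_derivable.
by rewrite -derive_gradient // /derive E.
Qed.

(** The lower half of the quadratic bound for smooth functions. Read as [f 0 <= f 1], it follows
    once [df] is nonnegative at the mean value point. *)
Lemma smooth_lower_bound (L : R) J x v : 0 < L -> L_smooth L J ->
  J x + dot (gradient J x) v - L / 2 * dot v v <= J (x + v).
Proof.
move=> L0 [Jd JL].
pose g := dot (gradient J x) v; pose q := L / 2 * dot v v.
(* The term [q t^2] has derivative [L t |v|^2], exactly the largest drop in slope that smoothness
   allows. *)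
pose f (t : R) := J (x + t *: v) - g * t + q * t ^+ 2.
pose df (t : R) := dot (gradient J (x + t *: v)) v - g + q * (2 * t).
have fE (t : R) : is_derive t 1 f (df t).
  have Jt := is_derive_line (Jd (x + t *: v)).
  rewrite /f; apply: is_derive_eq.
  by rewrite /df /GRing.scale /=; ring.
have cf : {within `[0, 1], continuous f}.
  by apply: derivable_within_continuous => t _; apply: ex_derive.
have [t] := MVT (@ltr01 R) (fun t _ => fE t) cf.
rewrite in_itv /= => /andP[t0 _].
(* The constant [L * t] is positive because the mean value point is interior to the segment. *)
have := @dot_ge_of_norm_le (L * t) (gradient J (x + t *: v) - gradient J x) v.
rewrite dotBl mulr_gt0 // => /(_ isT).
have -> : L * t * euclidean_norm v = L * euclidean_norm (x + t *: v - x).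
  rewrite addrC addKr -mulrA; congr (_ * _).
  (* Both sides are nonnegative, so their squares are compared. *)
  apply/eqP; rewrite -(@eqrXn2 _ 2) ?mulr_ge0 ?euclidean_norm_ge0 ?ltW //.
  by rewrite exprMn !euclidean_norm_sqr dotZl dotZr mulrA expr2.
move=> /(_ (JL _ _)).
rewrite /f /df scale1r scale0r addr0 -/g /q; lra.
Qed.

Lemma smooth_ascent (L eta : R) J x : 0 < L -> L_smooth L J ->
  0 < eta -> eta < 2 / L -> gradient J x != 0 ->
  J x < J (x + eta *: gradient J x).
Proof.
move=> L0 JL eta0 etaL /dotvv_gt0 g0.
apply: lt_le_trans (smooth_lower_bound _ _ L0 JL).
rewrite dotZr dotZl dotZr; move: etaL; rewrite ltr_pdivlMr // => etaL.
(* This product is twice the gain guaranteed by the quadratic bound. *)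
have : 0 < eta * dot (gradient J x) (gradient J x) * (2 - eta * L).
  by rewrite !mulr_gt0 // subr_gt0.
lra.
Qed.

End AscentLemma.

Theorem mainTheorem1 (R : realType) (d : nat) (dS dA : measure_display)
    (S : measurableType dS) (A : measurableType dA) (M : MDP S A R)
    (pi : 'rV[R]_d -> R.-pker S ~> A)
    (P : 'rV[R]_d -> probability (trajectory S A) R)
    (P_law : forall theta, trajectory_law M (pi theta) (P theta))
    (J_finite : forall theta, return_well_defined M (P theta))
    (L eta : R) (theta_k : 'rV[R]_d) :
  let J := fun theta => expected_return M (P theta) in
  let theta_explore := theta_k + eta *: gradient J theta_k in
  0 < L -> L_smooth L J ->
  0 < eta -> eta < 2 / L ->
  gradient J theta_k <> 0 ->
  J theta_k < J theta_explore.
Proof.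
by move=> J theta_explore L0 JL eta0 etaL /eqP; exact: smooth_ascent L0 JL eta0 etaL.
Qed.
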